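(* For the approximation problem $\mathrm{APP}=\{\mathrm{APP}_s\}_{s\in\mathbb N}$ the following are equivalent: $\mathrm{APP}$ is EC-PT; $\mathrm{APP}$ is EC-SPT; the conditions $$m_0=1,\qquad B:=\sum_{j=1}^\infty\frac1{b_j}<\infty,\qquad\text{and}\qquad\alpha^*:=\liminf_{j\to\infty}\frac{\log a_j}{j}>0$$ hold. If these conditions hold, then the exponent of EC-SPT satisfies $$p^*\in\left[\max\left(B,\frac{\log(1+m_1)}{\alpha^*}\right),\ B+\frac{\log(1+m_{\max})}{\alpha^*}\right].$$ In particular, if $\alpha^*=\infty$ then $p^*=B$.
   Context: Notation: $\mathbb N=\{1,2,\dots\}$, $\mathbb N_0=\{0,1,2,\dots\}$; $\log$ is the natural logarithm; $\alpha^*$ may equal $+\infty$, in which case quotients by $\alpha^*$ are read as $0$. Setting. $H$ is an infinite-dimensional separable Hilbert space over $\mathbb R$ or $\mathbb C$ with orthonormal basis $\{e_k\}_{k\in\mathbb N_0}$; $\omega\in(0,1)$; $\boldsymbol m=\{m_k\}_{k\in\mathbb N_0}$ is a bounded sequence of positive integers, $m_{\max}=\max_{k\in\mathbb N}m_k$; $r_0=0$ and $r_k=m_0+\cdots+m_{k-1}$ for $k\ge1$. For $n\in\mathbb N_0$ let $k(n)$ be the unique $k\in\mathbb N_0$ with $r_k\le n\le r_{k+1}-1$. For $a,b>0$ let $$H_{a,b}=\Big\{f\in H:\ \|f\|_{H_{a,b}}:=\Big(\sum_{k=0}^\infty\omega^{-ak^b}\sum_{j=r_k}^{r_{k+1}-1}|\langle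 f,e_j\rangle_H|^2\Big)^{1/2}<\infty\Big\}.$$ The sequences $\boldsymbol a=\{a_j\}_{j\in\mathbb N}$, $\boldsymbol b=\{b_j\}_{j\in\mathbb N}$ consist of positive reals with $0<a_1\le a_2\le\cdots$ and $\inf_jb_j>0$. Let $H_s=H\otimes\cdots\otimes H$ ($s$-fold Hilbert tensor product) with orthonormal basis $e_{\boldsymbol n}=e_{n_1}\otimes\cdots\otimes e_{n_s}$, $\boldsymbol n\in\mathbb N_0^s$, and $H_{s,\boldsymbol a,\boldsymbol b}=H_{a_1,b_1}\otimes\cdots\otimes H_{a_s,b_s}$; equivalently, $H_{s,\boldsymbol a,\boldsymbol b}$ is the set of $f\in H_s$ with $\|f\|_{H_{s,\boldsymbol a,\boldsymbol b}}^2=\sum_{\boldsymbol n\in\mathbb N_0^s}\omega^{-\sum_{j=1}^sa_j[k(n_j)]^{b_j}}|\langle f,e_{\boldsymbol n}\rangle_{H_s}|^2<\infty$. The operator $\mathrm{APP}_s:H_{s,\boldsymbol a,\boldsymbol b}\to H_s$ is the embedding $\mathrm{APP}_sf=f$. Information complexity. For $n\in\mathbb N_0$, $e(n,\mathrm{APP}_s)=\inf_{A_n}\sup_{\|f\|_{H_{s,\boldsymbol a,\boldsymbol b}}\le1}\|f-A_nf\|_{H_s}$, the infimum being over all algorithms $A_nf=\sum_{j=1}^nL_j(f)g_j$ with continuous linear functionals $L_j$ on $H_{s,\boldsymbol a,\boldsymbol b}$ and $g_j\in H_s$ ($A_0=0$). For $\varepsilon>0$, $n(\varepsilon,\mathrm{APP}_s)=\min\{n\in\mathbb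 N_0:\ e(n,\mathrm{APP}_s)\le\varepsilon\}$. EC-PT means that there are $C,p>0$ and $q\ge0$ such that $n(\varepsilon,\mathrm{APP}_s)\le C\,s^{q}\,(1+\log\varepsilon^{-1})^{p}$ for all $s\in\mathbb N$, $\varepsilon\in(0,1)$. EC-SPT means that such a bound holds with $q=0$; the infimum of the $p$ in this bound (with $q=0$) is denoted $p^*$ and called the exponent of EC-SPT. *)

(* Defs.v *)
From HB Require Import structures.
From mathcomp Require Import all_boot all_order all_algebra.
From mathcomp Require Import complex.
From mathcomp Require Import all_classical all_reals all_analysis.
Import Order.TTheory GRing.Theory Num.Theory.
Import numFieldNormedType.Exports.

Set Implicit Arguments.
Unset Strict Implicit.
Unset Printing Implicit Defensive.

Local Open Scope classical_set_scope.
Local Open Scope ring_scope.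

Inductive scalar_kind := RealScalars | ComplexScalars.

Definition scalars (R : realType) (k : scalar_kind) : numFieldType :=
  match k with RealScalars => R | ComplexScalars => R[i] end.

Definition scalar_conj (R : realType) (k : scalar_kind) :
    scalars R k -> scalars R k :=
  match k with RealScalars => idfun | ComplexScalars => @conjc R end.

Definition scalar_re (R : realType) (k : scalar_kind) : scalars R k -> R :=
  match k with RealScalars => idfun | ComplexScalars => @complex.Re R end.

(* The library's norms take values in the scalar field, hence in R[i] in the
   complex case; [modulus] and [hnorm] are the same norms with values in R. *)
Definition modulus (R : realType) (k : scalar_kind) (z : scalars R k) : R :=
  scalar_re `|z|.

(* [hdot] is linear in its first argument. *)
Record hilbertSpace (R : realType) (k : scalar_kind) := HilbertSpace {
  hsort :> completeNormedModType (scalars R k);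
  hdot : {dot hsort for @scalar_conj R k};
  hdotE : forall x : hsort, hdot x x = `|x| ^+ 2 }.

Definition hnorm (R : realType) (k : scalar_kind) (H : hilbertSpace R k)
  (x : H) : R := scalar_re `|x|.

Definition lin_span (K : numFieldType) (V : lmodType K) (A : set V) : set V :=
  [set x | exists (n : nat) (c : 'I_n -> K) (v : 'I_n -> V),
     (forall i, A (v i)) /\ x = \sum_(i < n) c i *: v i].

(* A basis indexed by nat: its existence makes H infinite-dimensional and
   separable. *)
Definition orthonormal_basis (R : realType) (k : scalar_kind)
    (H : hilbertSpace R k) (e : nat -> H) : Prop :=
  (forall i j, hdot H (e i) (e j) = (i == j)%:R) /\
  closure (lin_span (range e)) = [set: H].

(* The s-fold Hilbert tensor power of H, characterized up to isometric
   isomorphism: a Hilbert space with a multilinear map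
   (u_1, ..., u_s) |-> u_1 (x) ... (x) u_s such that inner products of
   elementary tensors are the products of the inner products, and whose
   elementary tensors span a dense subspace. *)
Record hilbert_tensor_power (R : realType) (k : scalar_kind)
    (H : hilbertSpace R k) (s : nat) := HilbertTensorPower {
  tensor_space :> hilbertSpace R k;
  tensor : ('I_s -> H) -> tensor_space;
  tensor_multilinear : forall (u : 'I_s -> H) (i : 'I_s)
      (c : scalars R k) (x y : H),
    tensor [eta u with i |-> c *: x + y] =
    c *: tensor [eta u with i |-> x] + tensor [eta u with i |-> y];
  tensor_dot : forall u v : 'I_s -> H,
    hdot tensor_space (tensor u) (tensor v) =
    \prod_(j < s) hdot H (u j) (v j);
  tensor_dense : closure (lin_span (range tensor)) = [set: tensor_space] }.

Definition partial_sum (m : nat -> nat) (k : nat) : nat := (\sum_(i < k) m i)%N.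

Definition block_index (m : nat -> nat) (n : nat) : nat :=
  xget 0%N [set k | (partial_sum m k <= n < partial_sum m k.+1)%N].

(* The maximum of m over the indices k >= 1 (m 0 is excluded), as a real
   number; for a bounded m the supremum is attained. *)
Definition m_max (R : realType) (m : nat -> nat) : R :=
  sup [set (m k)%:R | k in [set k | (1 <= k)%N]].

Section Approximation.
Context (R : realType) (k : scalar_kind) (H : hilbertSpace R k) (e : nat -> H).
(* The sequences a and b are indexed from 1; a 0 and b 0 are never used. *)
Context (omega : R) (m : nat -> nat) (a b : nat -> R).
Context (s : nat) (Hs : hilbert_tensor_power H s).

Definition tensor_basis (n : {ffun 'I_s -> nat}) : Hs :=
  tensor Hs (fun j => e (n j)).

(* The norm of H_{s,a,b}, with value +oo outside of H_{s,a,b}. *)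
Definition weighted_norm (f : Hs) : \bar R :=
  sqrte (\esum_(n in [set: {ffun 'I_s -> nat}])
    (omega `^ (- \sum_(j < s) a j.+1 * (block_index m (n j))%:R `^ b j.+1)
     * modulus (hdot Hs f (tensor_basis n)) ^+ 2)%:E).

Definition weighted_space : set Hs := [set f | (weighted_norm f < +oo)%E].

(* Functionals and algorithms on H_{s,a,b} are represented by functions on Hs
   whose values outside of H_{s,a,b} are irrelevant. *)
Definition continuous_linear_functional (L : Hs -> scalars R k) : Prop :=
  (forall (c : scalars R k) (f g : Hs),
     weighted_space f -> weighted_space g ->
     L (c *: f + g) = c * L f + L g) /\
  (forall f : Hs, weighted_space f ->
     forall eps : R, 0 < eps -> exists2 delta : R, 0 < delta &
       forall g : Hs, weighted_space g ->
         (weighted_norm (g - f)%R < delta%:E)%E -> modulus (L g - L f) < eps).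

Definition linear_algorithms (n : nat) : set (Hs -> Hs) :=
  [set A | exists (L : 'I_n -> Hs -> scalars R k) (g : 'I_n -> Hs),
     (forall j, continuous_linear_functional (L j)) /\
     (forall f, weighted_space f -> A f = \sum_(j < n) L j f *: g j)].

Definition worst_case_error (A : Hs -> Hs) : \bar R :=
  ereal_sup [set (hnorm (f - A f))%:E
            | f in [set f | (weighted_norm f <= 1)%E]].

Definition minimal_error (n : nat) : \bar R :=
  ereal_inf [set worst_case_error A | A in linear_algorithms n].

(* The minimum of a set of natural numbers, read as +oo on the empty set. *)
Definition information_complexity (eps : R) : \bar R :=
  ereal_inf [set n%:R%:E | n in [set n | (minimal_error n <= eps%:E)%E]].

End Approximation.

Section Tractability.
Context (R : realType) (N : nat -> R -> \bar R).

Definition ec_bound (C p q : R) : Prop :=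
  forall (s : nat) (eps : R), (1 <= s)%N -> 0 < eps < 1 ->
    (N s eps <= (C * s%:R `^ q * (1 + ln eps^-1) `^ p)%:E)%E.

Definition EC_PT : Prop :=
  exists C p q : R, [/\ 0 < C, 0 < p, 0 <= q & ec_bound C p q].

Definition EC_SPT_with (p : R) : Prop :=
  exists2 C : R, 0 < C & ec_bound C p 0.

Definition EC_SPT : Prop := exists2 p : R, 0 < p & EC_SPT_with p.

Definition EC_SPT_exponent : \bar R :=
  ereal_inf [set p%:E | p in [set p | 0 < p /\ EC_SPT_with p]].

End Tractability.

Definition sum_inv (R : realType) (b : nat -> R) : \bar R :=
  (\sum_(1 <= j <oo) ((b j)^-1)%:E)%E.

Definition alpha_star (R : realType) (a : nat -> R) : \bar R :=
  limn_einf (fun j => (ln (a j) / j%:R)%:E).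

(* Main.v *)
(* The weight of e_n in the squared norm of H_{s,a,b} is omega^(-cost n) with
   cost n = sum_j a_j k(n_j)^(b_j), so n(eps, APP_s) is the number of n with
   cost n * ln (1/omega) < 2 ln (1/eps): orthogonal projection on the
   corresponding e_n attains error eps, and fewer functionals all vanish on some
   unit combination of these e_n. Throughout, y stands for ln (1/eps).

   This number is estimated by boxes of indices. For the necessity of the
   conditions, boxes inside the set give lower bounds: n_j < m_0 has cost 0 and
   m_0^s elements, which forces m_0 = 1; block indices up to z^(1/b_j), with
   z -> oo for fixed s, give sum_(j <= s) 1/b_j <= p; the blocks 0 and 1, with y
   of order s * a_s, give (1 + m_1)^s <= C s^q (1 + y)^p and hence
   alpha* >= ln (1 + m_1) / p. For sufficiency, put x = 2 y / ln (1/omega). The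
   set lies in the box where the j-th block index is at most (x / a_j)^(1/b_j);
   this is 0 unless a_j <= x, which holds for at most const + ln x / delta
   coordinates when delta < alpha*. The box then has at most a constant times
   (1 + y)^(B + ln (1 + m_max) / delta) elements, and delta is chosen to make
   this exponent any given p > B + ln (1 + m_max) / alpha*. *)
Require Import Defs.
From mathcomp Require Import all_boot all_order all_algebra.
From mathcomp Require Import complex lra.
From mathcomp Require Import all_classical all_reals all_analysis.
Import Order.TTheory GRing.Theory Num.Theory.
Import numFieldNormedType.Exports.

Set Implicit Arguments.
Unset Strict Implicit.
Unset Printing Implicit Defensive.

Local Open Scope classical_set_scope.
Local Open Scope ring_scope.

(** * Scalars and Hilbert spaces *)

Section Scalars.
Context (R : realType) (k : scalar_kind).
Local Notation K := (scalars R k).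

(** Norm identities and inequalities in [K] are moved to [R] along this embedding, so both kinds of
    scalars share one proof. *)
Definition of_real : R -> K :=
  match k with RealScalars => idfun | ComplexScalars => fun x => x%:C%C end.

Lemma of_realD : {morph of_real : x y / x + y}.
Proof. by rewrite /of_real; case: k => //= x y; rewrite rmorphD. Qed.

Lemma of_realM : {morph of_real : x y / x * y}.
Proof. by rewrite /of_real; case: k => //= x y; rewrite rmorphM. Qed.

Lemma of_real0 : of_real 0 = 0.
Proof. by rewrite /of_real; case: k. Qed.

Lemma of_real1 : of_real 1 = 1.
Proof. by rewrite /of_real; case: k. Qed.

Lemma of_real_sum I (r : seq I) (F : I -> R) :
  of_real (\sum_(i <- r) F i) = \sum_(i <- r) of_real (F i).
Proof. by rewrite (big_morph of_real of_realD of_real0). Qed.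

Lemma of_realX n : {morph of_real : x / x ^+ n}.
Proof.
by move=> x; elim: n => [|n IH]; rewrite ?expr0 ?of_real1// !exprS of_realM IH.
Qed.

Lemma ler_of_real x y : (of_real x <= of_real y) = (x <= y).
Proof. by rewrite /of_real; case: k => //=; rewrite lecR. Qed.

Lemma ltr_of_real x y : (of_real x < of_real y) = (x < y).
Proof. by rewrite /of_real; case: k => //=; rewrite ltcR. Qed.

Lemma of_real_inj : injective of_real.
Proof. by rewrite /of_real; case: k => //= x y [->]. Qed.

Lemma ge0_of_real (z : K) : 0 <= z -> of_real (scalar_re z) = z.
Proof.
rewrite /of_real /scalar_re; move: z; case: k => //= z z0.
by rewrite RRe_real// realE z0.
Qed.

Lemma modulusE (z : K) : `|z| = of_real (modulus z).
Proof. by rewrite ge0_of_real. Qed.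

Lemma modulus_ge0 (z : K) : 0 <= modulus z.
Proof. by rewrite -ler_of_real of_real0 -modulusE. Qed.

Lemma modulus_eq0 (z : K) : (modulus z == 0) = (z == 0).
Proof.
by rewrite -(inj_eq of_real_inj) of_real0 -modulusE normr_eq0.
Qed.

Lemma modulus0 : @modulus R k 0 = 0.
Proof. by apply/eqP; rewrite modulus_eq0. Qed.

Lemma modulus_of_real x : modulus (of_real x) = `|x|.
Proof.
rewrite /modulus/of_real/scalar_re; move: x; case: k => //= x.
by rewrite expr0n addr0 sqrtr_sqr.
Qed.

Lemma mul_scalar_conj (z : K) :
  z * @scalar_conj R k z = of_real (modulus z ^+ 2).
Proof.
rewrite of_realX -modulusE; rewrite /scalar_conj; move: z; case: k => //= z.
  by rewrite real_normK ?num_real.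
by rewrite normcE sqr_sqrtc.
Qed.

Lemma scalar_conj0 : @scalar_conj R k 0 = 0.
Proof. by rewrite /scalar_conj; case: k => //=; exact: conjc0. Qed.

End Scalars.

Arguments of_real {R} k x.

Section HilbertSpace.
Context (R : realType) (k : scalar_kind) (H : hilbertSpace R k).
Local Notation K := (scalars R k).
Implicit Types (x y z : H) (c : K).

Lemma hnormE x : `|x| = of_real k (hnorm x).
Proof. by rewrite ge0_of_real. Qed.

Lemma hnorm_ge0 x : 0 <= hnorm x.
Proof. by rewrite -(ler_of_real k) of_real0 -hnormE. Qed.

Lemma hnorm_eq0 x : (hnorm x == 0) = (x == 0).
Proof. by rewrite -(inj_eq (@of_real_inj R k)) of_real0 -hnormE normr_eq0. Qed.

Lemma hnorm0 : hnorm (0 : H) = 0.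
Proof. by apply/eqP; rewrite hnorm_eq0. Qed.

Lemma hnormZ c x : hnorm (c *: x) = modulus c * hnorm x.
Proof.
by apply: (@of_real_inj R k); rewrite of_realM -!hnormE -modulusE normrZ.
Qed.

Lemma ler_hnormD x y : hnorm (x + y) <= hnorm x + hnorm y.
Proof. by rewrite -(ler_of_real k) of_realD -!hnormE ler_normD. Qed.

Lemma hdotDl z : {morph (fun x => hdot H x z) : x y / x + y}.
Proof. by move=> x y; apply: linearDl. Qed.

Lemma hdotBl z : {morph (fun x => hdot H x z) : x y / x - y}.
Proof. by move=> x y; apply: linearBl. Qed.

Lemma hdotDr z : {morph hdot H z : x y / x + y}.
Proof. by move=> x y; apply: linearDr. Qed.

Lemma hdotBr z : {morph hdot H z : x y / x - y}.
Proof. by move=> x y; apply: linearBr. Qed.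

Lemma hdot0l z : hdot H 0 z = 0. Proof. exact: linear0l. Qed.

Lemma hdot0r z : hdot H z 0 = 0. Proof. exact: linear0r. Qed.

Lemma hdotZl c x z : hdot H (c *: x) z = c * hdot H x z.
Proof. exact: linearl_subproof. Qed.

Lemma hdotZr c x z : hdot H z (c *: x) = scalar_conj c * hdot H z x.
Proof. exact: linearr_subproof. Qed.

Lemma hdot_suml I (r : seq I) (F : I -> H) z :
  hdot H (\sum_(i <- r) F i) z = \sum_(i <- r) hdot H (F i) z.
Proof. exact: (big_morph _ (hdotDl z) (hdot0l z)). Qed.

Lemma hdot_sumr I (r : seq I) (F : I -> H) z :
  hdot H z (\sum_(i <- r) F i) = \sum_(i <- r) hdot H z (F i).
Proof. exact: (big_morph _ (hdotDr z) (hdot0r z)). Qed.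

Lemma hdotC x y : hdot H x y = scalar_conj (hdot H y x).
Proof. by rewrite hermitian_subproof expr0 mul1r. Qed.

Lemma hdotxx x : hdot H x x = of_real k (hnorm x ^+ 2).
Proof. by rewrite hdotE hnormE of_realX. Qed.

Lemma pythagoras x y : hdot H x y = 0 ->
  hnorm (x + y) ^+ 2 = hnorm x ^+ 2 + hnorm y ^+ 2.
Proof.
move=> xy; have yx : hdot H y x = 0 by rewrite hdotC xy scalar_conj0.
apply: (@of_real_inj R k); rewrite of_realD -!hdotxx hdotDl !hdotDr xy yx.
by rewrite addr0 add0r.
Qed.

Lemma closure_setT_approx (S : set H) : closure S = [set: H] ->
  forall x (eta : R), 0 < eta -> exists2 y, S y & hnorm (x - y) < eta.
Proof.
move=> clS x eta eta0; have : closure S x by rewrite clS.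
move=> /(_ (ball x (of_real k eta))) [].
  by apply: nbhsx_ballx; rewrite -(of_real0 R k) ltr_of_real.
move=> y [Sy xy]; exists y => //.
by move: xy; rewrite -ball_normE /= hnormE ltr_of_real.
Qed.

End HilbertSpace.

(** * Orthonormal families and tensor bases *)

Section OrthonormalFamily.
Context (R : realType) (k : scalar_kind) (V : hilbertSpace R k).
Local Notation K := (scalars R k).
Context (I : choiceType) (E : I -> V).

(** Lists of pairs may repeat an index, so that a sum of two combinations is a concatenation of
    lists. *)
Definition lincomb (r : seq (K * I)) : V := \sum_(p <- r) p.1 *: E p.2.

Definition approximable (f : V) : Prop :=
  forall eta : R, 0 < eta -> exists r, hnorm (f - lincomb r) < eta.

Lemma approximable_lincomb r : approximable (lincomb r).
Proof. by move=> eta eta0; exists r; rewrite subrr hnorm0. Qed.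

Lemma approximable0 : approximable 0.
Proof. by have := approximable_lincomb [::]; rewrite /lincomb big_nil. Qed.

Lemma approximableD f g : approximable f -> approximable g -> approximable (f + g).
Proof.
move=> fA gA eta eta0; have eta20 : 0 < eta / 2 by rewrite divr_gt0.
have [r fr] := fA _ eta20; have [r' gr'] := gA _ eta20.
exists (r ++ r'); rewrite /lincomb big_cat/= opprD addrACA.
by rewrite (le_lt_trans (ler_hnormD _ _))// (splitr eta) ltrD.
Qed.

Lemma approximableZ c f : approximable f -> approximable (c *: f).
Proof.
move=> fA eta eta0; have c0 := modulus_ge0 c.
have [|r fr] := fA (eta / (1 + modulus c)); first by rewrite divr_gt0// ltr_wpDr.
exists [seq (c * p.1, p.2) | p <- r].
have -> : lincomb [seq (c * p.1, p.2) | p <- r] = c *: lincomb r.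
  rewrite /lincomb big_map scaler_sumr.
  by apply: eq_bigr => p _ /=; rewrite scalerA.
rewrite -scalerBr hnormZ; move: fr; rewrite ltr_pdivlMr ?ltr_wpDr// => fr.
have := hnorm_ge0 (f - lincomb r); nra.
Qed.

Lemma approximable_closed f :
  (forall eta : R, 0 < eta -> exists2 g, approximable g & hnorm (f - g) < eta) ->
  approximable f.
Proof.
move=> fA eta eta0; have eta20 : 0 < eta / 2 by rewrite divr_gt0.
have [g gA fg] := fA _ eta20; have [r gr] := gA _ eta20; exists r.
rewrite (_ : f - _ = (f - g) + (g - lincomb r)); last by rewrite addrA subrK.
by rewrite (le_lt_trans (ler_hnormD _ _))// (splitr eta) ltrD.
Qed.

Hypothesis E_orthonormal : forall i j, hdot V (E i) (E j) = (i == j)%:R.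

Lemma hdot_sum_family (T : seq I) (c : I -> K) n : uniq T ->
  hdot V (\sum_(i <- T) c i *: E i) (E n) = if n \in T then c n else 0.
Proof.
move=> uT; rewrite hdot_suml.
under eq_bigr do rewrite hdotZl E_orthonormal.
case: ifPn => nT; last first.
  apply: big1_seq => i /andP[_ iT].
  by case: eqVneq => [in_|]; rewrite ?mulr0//; move: nT; rewrite -in_ iT.
rewrite (bigD1_seq n)//= eqxx mulr1 big1 ?addr0// => i /negPf ->.
by rewrite mulr0.
Qed.

Lemma hnorm_sum_family (T : seq I) (c : I -> K) : uniq T ->
  hnorm (\sum_(i <- T) c i *: E i) ^+ 2 = \sum_(i <- T) modulus (c i) ^+ 2.
Proof.
move=> uT; apply: (@of_real_inj R k); rewrite -hdotxx hdot_sumr of_real_sum.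
rewrite big_seq [RHS]big_seq; apply: eq_bigr => i iT.
by rewrite hdotZr hdot_sum_family// iT mulrC mul_scalar_conj.
Qed.

Definition proj (T : seq I) (f : V) : V := \sum_(i <- T) hdot V f (E i) *: E i.

Lemma hdot_sub_proj (T : seq I) f n : uniq T ->
  hdot V (f - proj T f) (E n) = if n \in T then 0 else hdot V f (E n).
Proof.
by move=> uT; rewrite hdotBl hdot_sum_family//; case: ifP; rewrite ?subrr ?subr0.
Qed.

Lemma hdot_sub_proj_lincomb (T : seq I) f r : uniq T ->
  {subset [seq p.2 | p <- r] <= T} -> hdot V (f - proj T f) (lincomb r) = 0.
Proof.
move=> uT rT; rewrite /lincomb hdot_sumr big1_seq// => p /andP[_ pr].
by rewrite hdotZr hdot_sub_proj// rT ?mulr0// map_f.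
Qed.

Lemma proj_lincomb (T : seq I) f :
  proj T f = lincomb [seq (hdot V f (E i), i) | i <- T].
Proof. by rewrite /lincomb big_map. Qed.

(** Pythagoras: the residual is orthogonal to the span of the projection. Bessel's inequality is
    contained in this identity. *)
Lemma hnorm_proj (T : seq I) f : uniq T ->
  hnorm f ^+ 2 = hnorm (f - proj T f) ^+ 2
                 + \sum_(i <- T) modulus (hdot V f (E i)) ^+ 2.
Proof.
move=> uT; rewrite -hnorm_sum_family// -pythagoras ?subrK//.
rewrite [X in hdot V _ X]proj_lincomb hdot_sub_proj_lincomb//.
by move=> i; rewrite -map_comp map_id.
Qed.

(** Best approximation: [f - lincomb r] is the residual of the projection plus a vector of the span,
    and the two are orthogonal. *)
Lemma hnorm_sub_proj_le f r :
  hnorm (f - proj (undup [seq p.2 | p <- r]) f) <= hnorm (f - lincomb r).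
Proof.
set T := undup _; have uT : uniq T by exact: undup_uniq.
rewrite -(ler_pXn2r (_ : 0 < 2)%N) ?nnegrE ?hnorm_ge0//.
rewrite (_ : f - lincomb r = (f - proj T f) + (proj T f - lincomb r)); last first.
  by rewrite addrA subrK.
rewrite (@pythagoras _ _ _ (f - proj T f)) ?lerDl ?sqr_ge0//.
rewrite hdotBr [X in hdot V _ X - _]proj_lincomb !hdot_sub_proj_lincomb ?subrr//.
  by move=> i; rewrite mem_undup.
by move=> i; rewrite -map_comp map_id.
Qed.

(** The half of Parseval's identity that rests on density: projecting on the indices of a good
    approximant leaves a squared residual of at most [eta]. *)
Lemma hnorm_sqr_le f (C : R) : approximable f ->
  (forall T, uniq T -> \sum_(i <- T) modulus (hdot V f (E i)) ^+ 2 <= C) ->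
  hnorm f ^+ 2 <= C.
Proof.
move=> fA fC; apply/ler_addgt0Pl => eta eta0.
have [|r fr] := fA (Num.sqrt eta); first by rewrite sqrtr_gt0.
rewrite (hnorm_proj f (undup_uniq [seq p.2 | p <- r])).
rewrite lerD ?fC ?undup_uniq// -(sqr_sqrtr (ltW eta0)).
rewrite ler_pXn2r ?nnegrE ?hnorm_ge0 ?sqrtr_ge0//.
exact: le_trans (hnorm_sub_proj_le f r) (ltW fr).
Qed.

End OrthonormalFamily.

Section TensorBasis.
Context (R : realType) (k : scalar_kind) (H : hilbertSpace R k) (e : nat -> H).
Hypothesis e_basis : orthonormal_basis e.
Context (s : nat) (Hs : hilbert_tensor_power H s).
Local Notation K := (scalars R k).

Lemma tensor_basis_orthonormal n p :
  hdot Hs (tensor_basis e Hs n) (tensor_basis e Hs p) = (n == p)%:R.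
Proof.
rewrite /tensor_basis tensor_dot; under eq_bigr do rewrite e_basis.1.
have [->|np] := eqVneq n p; first by rewrite big1// => i _; rewrite eqxx.
have [i ni] : exists i, n i != p i.
  apply/existsP; apply: contraR np; rewrite negb_exists => /forallP np.
  by apply/eqP/ffunP => i; apply/eqP/negPn/np.
by rewrite (bigD1 i)//= (negPf ni) mul0r.
Qed.

Lemma hnorm_tensor (u : 'I_s -> H) : hnorm (tensor Hs u) = \prod_j hnorm (u j).
Proof.
apply/eqP; rewrite -(eqrXn2 (_ : 0 < 2)%N) ?hnorm_ge0//; last first.
  by apply: prodr_ge0 => j _; exact: hnorm_ge0.
apply/eqP/(@of_real_inj R k); rewrite -hdotxx tensor_dot.
rewrite -prodrXl (big_morph _ (@of_realM R k) (@of_real1 R k)).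
by apply: eq_bigr => j _; rewrite hdotxx.
Qed.

Lemma tensor_with0 (u : 'I_s -> H) i : tensor Hs [eta u with i |-> 0] = 0.
Proof.
have := tensor_multilinear Hs u i 1 0 0; rewrite !scale1r addr0.
by move=> /(congr1 (fun x => x - tensor Hs [eta u with i |-> 0])); rewrite addrK subrr.
Qed.

Lemma tensor_withB (u : 'I_s -> H) i x y :
  tensor Hs [eta u with i |-> x] - tensor Hs [eta u with i |-> y] =
  tensor Hs [eta u with i |-> x - y].
Proof.
by rewrite -(addrC (- y)) -(scaleN1r y) tensor_multilinear scaleN1r addrC.
Qed.

Lemma tensor_with_sum (u : 'I_s -> H) i n (c : 'I_n -> K) (v : 'I_n -> H) :
  tensor Hs [eta u with i |-> \sum_j c j *: v j] =
  \sum_j c j *: tensor Hs [eta u with i |-> v j].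
Proof.
elim/big_rec2 : _ => [|j x y _ <-]; first exact: tensor_with0.
exact: tensor_multilinear.
Qed.

Lemma with_id (u : 'I_s -> H) i : [eta u with i |-> u i] = u :> ('I_s -> H).
Proof. by apply/funext => j /=; case: eqP => [->|]. Qed.

Lemma hnorm_tensor_with (u : 'I_s -> H) i x :
  hnorm (tensor Hs [eta u with i |-> x]) =
  hnorm x * \prod_(j | j != i) hnorm (u j).
Proof.
rewrite hnorm_tensor (bigD1 i)//= eqxx; congr (_ * _).
by apply: eq_bigr => j /negPf ->.
Qed.

(* Coordinate by coordinate, a factor u_i is replaced by a finite combination
   of the e_n. *)
Lemma approximable_tensor_from (j : nat) (u : 'I_s -> H) :
  (forall i : 'I_s, (j <= i)%N -> range e (u i)) ->
  approximable (tensor_basis e Hs) (tensor Hs u).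
Proof.
(* [j] bounds the coordinates whose factor is still arbitrary. *)
elim: j u => [|j IH] u ue.
  have /choice[n nu] : forall i, exists n, e n = u i.
    by move=> i; have [n _ <-] := ue i (leq0n i); exists n.
  have -> : tensor Hs u = lincomb (tensor_basis e Hs) [:: (1, finfun n)].
    rewrite /lincomb big_seq1 scale1r; congr tensor.
    by apply/funext => i; rewrite ffunE nu.
  exact: approximable_lincomb.
have [js|sj] := ltnP j s; last first.
  by apply: IH => i ji; have := leq_trans sj ji; rewrite leqNgt ltn_ord.
pose i0 := Ordinal js; apply: approximable_closed => eta eta0.
(* Replacing the factor at [i0] moves the tensor by the norm of the change times [P]; the tolerance
   below divides by [1 + P] since [P] may vanish. *)
pose P := \prod_(i | i != i0) hnorm (u i).
have P0 : 0 <= P by apply: prodr_ge0 => i _; exact: hnorm_ge0.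
have [|v [n [c [w [we ->]]]] uv] :=
  closure_setT_approx e_basis.2 (u i0) (_ : 0 < eta / (1 + P)).
  by rewrite divr_gt0// ltr_wpDr.
exists (tensor Hs [eta u with i0 |-> \sum_l c l *: w l]).
  rewrite tensor_with_sum; elim/big_ind : _ => [||l _].
  - exact: approximable0.
  - exact: approximableD.
  - apply/approximableZ/IH => i ji /=; case: eqVneq => [_|ii0]; first exact: we.
    apply: ue; rewrite ltn_neqAle ji andbT; apply: contra_neq ii0 => ij.
    exact: val_inj.
rewrite -{1}(with_id u i0) tensor_withB hnorm_tensor_with -/P.
move: uv; rewrite ltr_pdivlMr ?ltr_wpDr// => uv.
by have := hnorm_ge0 (u i0 - \sum_l c l *: w l); nra.
Qed.

(** Elementary tensors span a dense subspace, and each is approximable because the hypothesis of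
    [approximable_tensor_from] is void for [j = s]. *)
Lemma tensor_basis_approximable (f : Hs) : approximable (tensor_basis e Hs) f.
Proof.
apply: approximable_closed => eta eta0.
have [g [n [c [v [vt ->]]]] fg] := closure_setT_approx (tensor_dense Hs) f eta0.
exists (\sum_i c i *: v i) => //; elim/big_ind : _ => [||l _].
- exact: approximable0.
- exact: approximableD.
- apply: approximableZ; have [u _ <-] := vt l.
  by apply: (@approximable_tensor_from s) => i; rewrite leqNgt ltn_ord.
Qed.

End TensorBasis.

(** * Information complexity as a counting function *)

(** The box is listed through the finite type of dependent functions into the ordinals ['I_(d j)],
    whose cardinality is the product of the sides. *)
Lemma box_seq (s : nat) (d : 'I_s -> nat) :
  exists T : seq {ffun 'I_s -> nat},
    [/\ uniq T, size T = (\prod_j d j)%N &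
        forall n, (n \in T) = [forall j, n j < d j]%N].
Proof.
pose F (f : {dffun forall j : 'I_s, 'I_(d j)}) : {ffun 'I_s -> nat} :=
  [ffun j => val (f j)].
exists [seq F f | f : {dffun forall j : 'I_s, 'I_(d j)}]; split.
- rewrite map_inj_uniq ?enum_uniq// => f g /ffunP fg; apply/ffunP => j.
  by apply: val_inj; have := fg j; rewrite !ffunE.
- rewrite size_map -cardE card_dep_ffun foldrE big_map big_enum.
  by apply: eq_bigr => j _; rewrite card_ord.
- move=> n; apply/mapP/forallP => [[f _ ->] j|nd]; first by rewrite ffunE ltn_ord.
  pose f : {dffun forall j : 'I_s, 'I_(d j)} := finfun (fun j => Ordinal (nd j)).
  exists f; first by rewrite mem_enum.
  by apply/ffunP => j; rewrite !ffunE.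
Qed.

Section InformationComplexity.
Context (R : realType) (k : scalar_kind) (H : hilbertSpace R k) (e : nat -> H).
Context (omega : R) (m : nat -> nat) (a b : nat -> R).
Context (s : nat) (Hs : hilbert_tensor_power H s).
Local Notation K := (scalars R k).
Hypothesis e_basis : orthonormal_basis e.
Hypothesis omega01 : 0 < omega < 1.
Hypothesis a_gt0 : forall j : nat, (1 <= j)%N -> 0 < a j.

Local Notation E := (tensor_basis e Hs).
Let E_orthonormal := tensor_basis_orthonormal e_basis Hs.

Definition index_cost (n : {ffun 'I_s -> nat}) : R :=
  \sum_(j < s) a j.+1 * (block_index m (n j))%:R `^ b j.+1.

Local Notation wt n := (omega `^ (- index_cost n)).
Local Notation wnorm := (@weighted_norm R k H e omega m a b s Hs).
Local Notation wspace := (@weighted_space R k H e omega m a b s Hs).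

Lemma wt_ge1 n : 1 <= wt n.
Proof.
rewrite -(powRr0 omega) ger_powR; first by [].
  by case/andP : omega01 => -> /ltW ->.
rewrite oppr_le0 sumr_ge0// => j _; rewrite mulr_ge0 ?powR_ge0//.
exact/ltW/a_gt0.
Qed.

(** The unordered sum is the supremum of its finite partial sums; later estimates of the norm are
    made on finite sums in this form. *)
Lemma weighted_norm_leP (f : Hs) C : 0 <= C ->
  (wnorm f <= C%:E)%E <->
  forall T, uniq T ->
    \sum_(n <- T) wt n * modulus (hdot Hs f (E n)) ^+ 2 <= C ^+ 2.
Proof.
move=> C0; have -> : C%:E = sqrte (C ^+ 2)%:E by rewrite /= sqrtr_sqr ger0_norm.
rewrite lee_sqrt ?lee_fin ?sqr_ge0//; split=> [fC T uT|fC].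
  rewrite -lee_fin; apply: le_trans fC; apply: esum_ge.
  exists [set` T]; first by split => //; exact: finite_seq.
  by rewrite -fsbig_seq// sumEFin.
apply: ge_ereal_sup => _ [A [/finite_seqP[T ->] _] <-].
have -> : [set` T] = [set` undup T].
  by apply/seteqP; split => i /=; rewrite mem_undup.
by rewrite -fsbig_seq ?undup_uniq// sumEFin lee_fin fC// undup_uniq.
Qed.

Lemma weighted_norm_le_space f C : (wnorm f <= C%:E)%E -> wspace f.
Proof. by move=> fC; rewrite /weighted_space/= (le_lt_trans fC)// ltry. Qed.

(** All weights are at least 1, so a coefficient is bounded by the weighted norm. Half of [eps]
    turns the nonstrict bound of [weighted_norm_leP] into a strict one. *)
Lemma continuous_coefficient n :
  continuous_linear_functional e omega m a b (fun f : Hs => hdot Hs f (E n)).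
Proof.
split=> [c f g _ _|f _ eps eps0]; first by rewrite hdotDl hdotZl.
have eps20 : 0 <= eps / 2 by rewrite divr_ge0 ?ltW.
exists (eps / 2); first by rewrite divr_gt0.
move=> g _ /ltW/(weighted_norm_leP _ eps20)/(_ [:: n] isT).
rewrite big_seq1 hdotBl => gf.
have : modulus (hdot Hs g (E n) - hdot Hs f (E n)) ^+ 2 <= (eps / 2) ^+ 2.
  by apply: le_trans gf; rewrite ler_peMl ?sqr_ge0 ?wt_ge1.
rewrite ler_pXn2r ?nnegrE ?modulus_ge0// => /le_lt_trans; apply.
by rewrite ltr_pdivrMr// ltr_pMr// ltr1n.
Qed.

(** The algorithm is the projection on [T]. Only coefficients outside [T] survive in the residual,
    and there the weight is at least [eps ^- 2], so the squared residual is at most [eps ^+ 2] on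
    the unit ball. *)
Lemma information_complexity_le T eps : uniq T -> 0 < eps ->
  (forall n, n \notin T -> (eps ^+ 2)^-1 <= wt n) ->
  (information_complexity e omega m a b Hs eps <= (size T)%:R%:E)%E.
Proof.
move=> uT eps0 Twt; apply: ereal_inf_lbound; exists (size T) => //=.
pose L (i : 'I_(size T)) (f : Hs) := hdot Hs f (E (tnth (in_tuple T) i)).
apply: (@le_trans _ _ (worst_case_error e omega m a b (proj E T))).
  apply: ereal_inf_lbound; exists (proj E T) => //.
  exists L, (fun i => E (tnth (in_tuple T) i)).
  split=> [i|f _]; first exact: continuous_coefficient.
  by rewrite /proj big_tnth.
apply: ge_ereal_sup => _ [f /= f1 <-]; rewrite lee_fin.
rewrite -(ler_pXn2r (_ : 0 < 2)%N) ?nnegrE ?hnorm_ge0 ?(ltW eps0)//.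
apply: (hnorm_sqr_le E_orthonormal); first exact: tensor_basis_approximable.
move=> T' uT'; have /weighted_norm_leP := f1; move=> /(_ ler01 T' uT') {}f1.
rewrite -[leRHS]mulr1 -ler_pdivrMl ?exprn_gt0//; rewrite expr1n in f1.
apply: le_trans f1; rewrite mulr_sumr ler_sum// => n _.
rewrite hdot_sub_proj//; case: ifPn => nT.
  rewrite modulus0 expr0n/= mulr0 mulr_ge0 ?sqr_ge0// ltW//.
  exact: lt_le_trans (wt_ge1 n).
by rewrite ler_wpM2r ?sqr_ge0// Twt.
Qed.

(** * Lower bound for the worst-case error *)

Section Lower.
Context (T : seq {ffun 'I_s -> nat}) (W : R).
Hypothesis T_uniq : uniq T.
Hypothesis W_gt0 : 0 < W.
Hypothesis T_wt : forall n, n \in T -> wt n <= W.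

Definition supported (f : Hs) : Prop := forall n, n \notin T -> hdot Hs f (E n) = 0.

Lemma supported_basis n : n \in T -> supported (E n).
Proof.
by move=> nT p; case: (eqVneq p n) => [->|/negPf pn _]; rewrite ?nT// E_orthonormal eq_sym pn.
Qed.

Lemma supportedP c f g : supported f -> supported g -> supported (c *: f + g).
Proof. by move=> fT gT n nT; rewrite hdotDl hdotZl fT// gT// mulr0 addr0. Qed.

Lemma supported0 : supported 0.
Proof. by move=> n _; rewrite hdot0l. Qed.

(** Bessel's inequality, with every contributing weight at most [W]. It also places supported
    vectors in the weighted space, where the functionals are linear. *)
Lemma supported_norm f : supported f -> (wnorm f <= (Num.sqrt W * hnorm f)%:E)%E.
Proof.
move=> fT; apply/weighted_norm_leP; first by rewrite mulr_ge0 ?sqrtr_ge0 ?hnorm_ge0.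
move=> T' uT'; rewrite exprMn sqr_sqrtr ?(ltW W_gt0)//.
apply: (@le_trans _ _ (W * \sum_(n <- T') modulus (hdot Hs f (E n)) ^+ 2)).
  rewrite mulr_sumr ler_sum// => n _.
  have [nT|nT] := boolP (n \in T); first by rewrite ler_wpM2r ?sqr_ge0 ?T_wt.
  by rewrite fT// modulus0 expr0n !mulr0.
by rewrite ler_wpM2l ?(ltW W_gt0)// (hnorm_proj E_orthonormal f uT') lerDr sqr_ge0.
Qed.

Lemma supported_space f : supported f -> wspace f.
Proof. by move=> /supported_norm/weighted_norm_le_space. Qed.

Section Functional.
Context (L : Hs -> K).
Hypothesis L_linear : forall (c : K) (f g : Hs), wspace f -> wspace g ->
  L (c *: f + g) = c * L f + L g.

Lemma functional0 : L 0 = 0.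
Proof.
have S0 := supported_space supported0.
by have := L_linear 1 S0 S0; rewrite scale1r mul1r addr0 -[LHS]addr0 => /addrI.
Qed.

Lemma functional_sum n (c : 'I_n -> K) (v : 'I_n -> Hs) :
  (forall i, supported (v i)) ->
  L (\sum_i c i *: v i) = \sum_i c i * L (v i).
Proof.
(* [L] is linear only on the weighted space, so the induction also carries that the partial sums are
   supported. *)
move=> vT; have : supported (\sum_i c i *: v i) /\
    L (\sum_i c i *: v i) = \sum_i c i * L (v i); last by case.
elim/big_rec2 : _ => [|i x y _ [yT IH]].
  by split; [exact: supported0|exact: functional0].
split; first exact: supportedP.
by rewrite L_linear ?IH//; exact: supported_space.
Qed.

End Functional.

(** The algorithm returns 0 at a vector annihilated by all its functionals, so its error there is
    the norm of that vector; scaled to norm [(Num.sqrt W)^-1], the vector lies in the weighted unit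
    ball by [supported_norm]. *)
Lemma worst_case_error_ge n (A : Hs -> Hs) : (n < size T)%N ->
  linear_algorithms e omega m a b n A ->
  ((Num.sqrt W)^-1%:E <= worst_case_error e omega m a b A)%E.
Proof.
move=> nT [L [g [Lc AE]]].
pose F i := E (tnth (in_tuple T) i).
have FT i : supported (F i) by apply: supported_basis; exact: mem_tnth.
pose M := \matrix_(i < size T, j < n) L j (F i).
(* Fewer functionals than basis tensors: some nonzero combination of the
   latter is annihilated by all the former. *)
have [v vM v0] : exists2 v : 'rV_(size T), v *m M = 0 & v != 0.
  have /rowV0Pn[v vM v0] : kermx M != 0.
    rewrite kermx_eq0; apply/negP => /eqP rM.
    by have := rank_leq_col M; rewrite rM leqNgt nT.
  by exists v => //; exact/sub_kermxP.
have F_orthonormal i j : hdot Hs (F i) (F j) = (i == j)%:R.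
  have /tuple_uniqP T_inj : uniq (in_tuple T) := T_uniq.
  by rewrite E_orthonormal (inj_eq T_inj).
pose f := \sum_i v 0 i *: F i.
have fT : supported f.
  rewrite /f; elim/big_rec : _ => [|i x _ xT]; first exact: supported0.
  exact: supportedP.
have f0 : 0 < hnorm f.
  rewrite lt_def hnorm_ge0 andbT; apply: contra v0 => /eqP f0.
  have := hnorm_sum_family F_orthonormal (v 0) (index_enum_uniq _).
  rewrite -/f f0 expr0n => /esym/psumr_eq0P => v0; apply/eqP/rowP => i.
  rewrite mxE; apply/eqP; rewrite -modulus_eq0 -sqrf_eq0; apply/eqP/v0 => //.
  by move=> j _; rewrite sqr_ge0.
have Lf j : L j f = 0.
  have [Ljl _] := Lc j; rewrite /f (functional_sum Ljl)//.
  have := congr1 (fun B : 'rV__ => B 0 j) vM; rewrite !mxE => vM0.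
  by rewrite -[RHS]vM0; apply: eq_bigr => i _; rewrite mxE.
have sW0 : 0 < Num.sqrt W by rewrite sqrtr_gt0.
pose t := (Num.sqrt W * hnorm f)^-1.
have t0 : 0 < t by rewrite invr_gt0 mulr_gt0.
(* The added 0 gives the vector the shape [c *: f + g] in which linearity is stated. *)
have hf : hnorm (of_real k t *: f + 0) = (Num.sqrt W)^-1.
  rewrite addr0 hnormZ modulus_of_real gtr0_norm// /t invfM -mulrA mulVf ?mulr1//.
  by rewrite gt_eqF.
have tfT : supported (of_real k t *: f + 0) by exact: supportedP supported0.
apply: le_ereal_sup_tmp; exists (Num.sqrt W)^-1%:E => //.
exists (of_real k t *: f + 0).
  have := supported_norm tfT.
  by rewrite hf divff ?gt_eqF.
rewrite AE ?big1 ?subr0 ?hf//; last exact: supported_space.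
move=> j _; have [Ljl _] := Lc j.
rewrite Ljl; [|exact: supported_space..|exact: (supported_space supported0)].
by rewrite Lf functional0// mulr0 addr0 scale0r.
Qed.

End Lower.

Lemma information_complexity_ge T eps : uniq T -> 0 < eps ->
  (forall n, n \in T -> wt n < (eps ^+ 2)^-1) ->
  ((size T)%:R%:E <= information_complexity e omega m a b Hs eps)%E.
Proof.
move=> uT eps0 Twt; apply: le_ereal_inf_tmp => _ [n /= neps <-].
rewrite lee_fin ler_nat leqNgt; apply/negP => nT; move: neps; apply/negP.
rewrite -ltNge.
(* As [T] is finite, its weights have a common bound strictly below [eps ^- 2]; strictness makes the
   error exceed [eps]. The induction starts from half of [eps ^- 2]. *)
have [W [W0 Weps WT]] : exists W, [/\ 0 < W, W < (eps ^+ 2)^-1 &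
    forall n, n \in T -> wt n <= W].
  elim: T Twt {uT nT} => [_|p T IH pTwt].
    exists ((eps ^+ 2)^-1 / 2); split=> //.
      by rewrite divr_gt0// invr_gt0 exprn_gt0.
    by rewrite gtr_pMr ?invr_gt0 ?exprn_gt0// invf_lt1// ltr1n.
  have [|W [W0 Weps WT]] := IH.
    by move=> q qT; apply: pTwt; rewrite inE qT orbT.
  exists (Num.max W (wt p)); split.
  - by rewrite lt_max W0.
  - by rewrite gt_max Weps pTwt// mem_head.
  - move=> q; rewrite inE => /predU1P[->|/WT qW]; rewrite le_max.
      by rewrite [X in _ || X]lexx orbT.
    by rewrite qW.
apply: (@lt_le_trans _ _ (Num.sqrt W)^-1%:E); last first.
  apply: le_ereal_inf_tmp => _ [A An <-].
  exact: (worst_case_error_ge uT W0 WT nT An).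
rewrite lte_fin -(ltr_pXn2r (_ : 0 < 2)%N) ?nnegrE ?invr_ge0 ?sqrtr_ge0 ?(ltW eps0)//.
by rewrite exprVn sqr_sqrtr ?(ltW W0)// -[ltLHS]invrK ltf_pV2 ?posrE ?invr_gt0 ?exprn_gt0.
Qed.

End InformationComplexity.

(** * Blocks of indices *)

Section BlockIndex.
Context (m : nat -> nat).
Hypothesis m_gt0 : forall i, (0 < m i)%N.

Lemma partial_sumS i : partial_sum m i.+1 = (partial_sum m i + m i)%N.
Proof. by rewrite /partial_sum big_ord_recr. Qed.

Lemma partial_sum1 : partial_sum m 1 = m 0.
Proof. by rewrite /partial_sum big_ord1. Qed.

Lemma leq_partial_sum : {homo partial_sum m : i j / (i <= j)%N}.
Proof.
apply: homo_leq; [exact: leqnn|exact: leq_trans|].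
by move=> i; rewrite partial_sumS leq_addr.
Qed.

Lemma partial_sum_ge i : (i <= partial_sum m i)%N.
Proof.
elim: i => // i IH; rewrite partial_sumS -addn1.
exact: leq_add IH (m_gt0 i).
Qed.

Lemma block_indexP n :
  (partial_sum m (block_index m n) <= n < partial_sum m (block_index m n).+1)%N.
Proof.
suff [i nI] : exists i, (partial_sum m i <= n < partial_sum m i.+1)%N.
  by rewrite /block_index; case: xgetP => [j _ //|/(_ i)]; rewrite /= nI.
(* The least such [i] is the block: its minimality gives the lower inequality. One exists because
   positive block lengths make the partial sums unbounded. *)
have n_lt : exists i, (n < partial_sum m i.+1)%N.
  by exists n; exact: partial_sum_ge.
exists (ex_minn n_lt); case: ex_minnP => -[|i] -> imin; rewrite andbT.
  by rewrite /partial_sum big_ord0.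
by rewrite leqNgt; apply/negP => /imin; rewrite ltnn.
Qed.

Lemma block_index_lt n i : (n < partial_sum m i)%N -> (block_index m n < i)%N.
Proof.
have /andP[n1 _] := block_indexP n; move=> ni; rewrite ltnNge.
by apply/negP => /leq_partial_sum /(leq_trans ni); rewrite ltnNge n1.
Qed.

Lemma block_index_ge n i : (partial_sum m i <= n)%N -> (i <= block_index m n)%N.
Proof.
have /andP[_ n2] := block_indexP n; move=> ni; rewrite leqNgt.
by apply/negP => /leq_partial_sum /(leq_trans n2); rewrite ltnNge ni.
Qed.

End BlockIndex.

(** * Bounding the complexity by boxes *)

Section Box.
Context (R : realType) (k : scalar_kind) (H : hilbertSpace R k) (e : nat -> H).
Context (omega : R) (m : nat -> nat) (a b : nat -> R).
Context (s : nat) (Hs : hilbert_tensor_power H s).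
Hypothesis e_basis : orthonormal_basis e.
Hypothesis omega01 : 0 < omega < 1.
Hypothesis a_gt0 : forall j : nat, (1 <= j)%N -> 0 < a j.

Lemma index_weightE (n : {ffun 'I_s -> nat}) :
  omega `^ (- index_cost m a b n) = expR (index_cost m a b n * - ln omega).
Proof.
have /andP[omega0 _] := omega01.
by rewrite /powR gt_eqF// mulrN mulNr.
Qed.

Lemma sqr_expRN_inv (y : R) : (expR (- y) ^+ 2)^-1 = expR (2 * y).
Proof. by rewrite expRN exprVn invrK -expRM_natl. Qed.

(** An index outside the box has some coordinate beyond its side, so the hypothesis says that the
    box contains all indices cheaper than the threshold. *)
Lemma information_complexity_box_le (d : 'I_s -> nat) (y : R) :
  (forall (n : {ffun 'I_s -> nat}) (j : 'I_s), (d j <= n j)%N ->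
    2 * y <= index_cost m a b n * - ln omega) ->
  (information_complexity e omega m a b Hs (expR (- y)) <=
   (\prod_j (d j)%:R)%:E)%E.
Proof.
move=> dy; have [T [uT sT Tin]] := box_seq d.
rewrite -natr_prod -sT; apply: information_complexity_le => //.
  exact: expR_gt0.
move=> n; rewrite Tin negb_forall => /existsP[j]; rewrite -leqNgt => dn.
by rewrite sqr_expRN_inv index_weightE ler_expR (dy n j).
Qed.

Lemma information_complexity_box_ge (d : 'I_s -> nat) (y : R) :
  (forall n : {ffun 'I_s -> nat}, (forall j : 'I_s, (n j < d j)%N) ->
    index_cost m a b n * - ln omega < 2 * y) ->
  ((\prod_j (d j)%:R)%:E <=
   information_complexity e omega m a b Hs (expR (- y)))%E.
Proof.
move=> dy; have [T [uT sT Tin]] := box_seq d.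
rewrite -natr_prod -sT; apply: information_complexity_ge => //.
  exact: expR_gt0.
move=> n; rewrite Tin => /forallP nd.
by rewrite sqr_expRN_inv index_weightE ltr_expR dy.
Qed.

End Box.

(** * Sequences of reals *)

Section RealAnalysis.
Context (R : realType).

(** The tangent bound ln u <= u - 1 at u = eta x; the slope can be made as small as desired. *)
Lemma ln_le_linear (eta x : R) : 0 < eta -> 0 < x -> ln x <= eta * x - 1 - ln eta.
Proof.
move=> eta0 x0; have ex0 : 0 < eta * x by rewrite mulr_gt0.
have : ln (1 + (eta * x - 1)) <= eta * x - 1 by apply: le_ln1Dx; lra.
by rewrite addrC subrK lnM ?posrE//; lra.
Qed.

Lemma log_lt_linear (A c q : R) : 0 < A -> 0 <= q ->
  exists N0, forall s : nat, (0 < s)%N -> (N0 <= s)%N ->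
    c + q * ln s%:R < s%:R * A.
Proof.
move=> A0 q0; have q1 : 0 < q + 1 by lra.
(* This slope spends at most half of [A] on the logarithm and leaves the other half for the
   constants; [q + 1] avoids division by 0. *)
pose eta := A / (2 * (q + 1)).
have eta0 : 0 < eta by rewrite divr_gt0// mulr_gt0.
have etaA : q * eta <= A / 2.
  by rewrite /eta mulrCA ler_pM2l// ler_pdivrMr ?mulr_gt0//; lra.
pose X := (c - q * (1 + ln eta)) / (A / 2).
exists (Num.truncn `|X|).+1 => s s0 sX.
have s0' : 0 < s%:R :> R by rewrite ltr0n.
have Xs : X < s%:R.
  apply: le_lt_trans (ler_norm _) _; apply: lt_le_trans (truncnS_gt _) _.
  by rewrite ler_nat.
have lns := ln_le_linear eta0 s0'.
move: Xs; rewrite /X ltr_pdivrMr ?divr_gt0// => Xs.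
have : q * ln s%:R <= q * (eta * s%:R - 1 - ln eta) by rewrite ler_wpM2l.
have : q * eta * s%:R <= A / 2 * s%:R by rewrite ler_wpM2r// ltW.
lra.
Qed.

Lemma limn_einf_ge (u : (\bar R)^nat) x N0 :
  (forall n, (N0 <= n)%N -> (x <= u n)%E) -> (x <= limn_einf u)%E.
Proof.
move=> ux; rewrite limn_einf_lim (cvg_lim _ (@cvg_einfs_sup _ u))//.
apply: le_ereal_sup_tmp; exists (einfs u N0); first by exists N0.
by apply: le_ereal_inf_tmp => _ [n /= Nn <-]; exact: ux.
Qed.

Lemma limn_einf_gt (u : (\bar R)^nat) x : (x < limn_einf u)%E ->
  exists N0, forall n, (N0 <= n)%N -> (x < u n)%E.
Proof.
rewrite limn_einf_lim (cvg_lim _ (@cvg_einfs_sup _ u))//.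
move=> /ereal_sup_gt[_ [N0 _ <-] xN]; exists N0 => n Nn.
by apply: lt_le_trans xN _; apply: ereal_inf_lbound; exists n.
Qed.

Lemma linear_le_affine (S p c : R) :
  (forall t, 0 <= t -> t * S <= c + t * p) -> S <= p.
Proof.
move=> SP; rewrite leNgt; apply/negP => pS.
have Sp0 : 0 < S - p by lra.
(* At this value of t, the product t (S - p) is |c| + 1, which exceeds c. *)
have t0 : 0 <= (`|c| + 1) / (S - p) by rewrite divr_ge0 ?ltW// ltr_wpDl.
have := SP _ t0; rewrite addrC -lerBlDr -mulrBr divfK ?gt_eqF//.
by have := ler_norm c; lra.
Qed.

Lemma sum_inv_ge (b : nat -> R) n : (forall j, (1 <= j)%N -> 0 < b j) ->
  ((\sum_(j < n) (b j.+1)^-1)%:E <= sum_inv b)%E.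
Proof.
move=> b0; rewrite -sumEFin.
have := @nneseries_lim_ge R (fun j => (b j)^-1%:E) xpredT 1 n.+1.
rewrite big_add1/= big_mkord; apply => j j0 _.
by rewrite lee_fin invr_ge0 ltW// b0.
Qed.

Lemma sum_inv_le (b : nat -> R) x : (forall j, (1 <= j)%N -> 0 < b j) ->
  (forall n, \sum_(j < n) (b j.+1)^-1 <= x) -> (sum_inv b <= x%:E)%E.
Proof.
move=> b0 bx; apply: lime_le.
  by apply: is_cvg_nneseries => j j0 _; rewrite lee_fin invr_ge0 ltW// b0.
apply: nearW => -[|n].
  by rewrite big_geq// lee_fin; have := bx 0%N; rewrite big_ord0.
by rewrite big_add1/= big_mkord sumEFin lee_fin.
Qed.

End RealAnalysis.

(** * Tractability *)

Section Tractability.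
Context (R : realType) (k : scalar_kind) (H : hilbertSpace R k) (e : nat -> H).
Context (Hs : forall s : nat, hilbert_tensor_power H s).
Context (omega : R) (m : nat -> nat) (a b : nat -> R).
Hypothesis e_basis : orthonormal_basis e.
Hypothesis omega01 : 0 < omega < 1.
Hypothesis m_gt0 : forall i : nat, (0 < m i)%N.
Hypothesis a_gt0 : forall j : nat, (1 <= j)%N -> 0 < a j.
Hypothesis a_ndecr : forall j : nat, (1 <= j)%N -> a j <= a j.+1.
Hypothesis b_gt0 : forall j : nat, (1 <= j)%N -> 0 < b j.

Local Notation N := (fun (s : nat) (eps : R) =>
  information_complexity e omega m a b (Hs s) eps).
Local Notation lam := (- ln omega).

Lemma lam_gt0 : 0 < lam.
Proof. by rewrite oppr_gt0 ln_lt0. Qed.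

Lemma a_le i j : (1 <= i <= j)%N -> a i <= a j.
Proof.
case/andP => i1; elim: j => [|j IH]; first by case: i i1.
rewrite leq_eqVlt => /predU1P[->//|]; rewrite ltnS => ij.
by rewrite (le_trans (IH ij))// a_ndecr// (leq_trans i1).
Qed.

(** * Necessity of the conditions and lower bounds for the exponent *)

Section Necessary.
Context (C p q : R).
Hypothesis C_gt0 : 0 < C.
Hypothesis p_gt0 : 0 < p.
Hypothesis q_ge0 : 0 <= q.
Hypothesis N_bound : ec_bound N C p q.

Lemma prod_box_le (s : nat) (d : 'I_s -> nat) y : (1 <= s)%N -> 0 < y ->
  (forall n : {ffun 'I_s -> nat}, (forall j : 'I_s, (n j < d j)%N) ->
    index_cost m a b n * lam < 2 * y) ->
  \prod_j (d j)%:R <= C * s%:R `^ q * (1 + y) `^ p.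
Proof.
move=> s1 y0 dy; rewrite -lee_fin.
apply: (le_trans (information_complexity_box_ge (Hs s) e_basis omega01 dy)).
have := N_bound s1 (_ : 0 < expR (- y) < 1).
rewrite expR_gt0 -expR0 ltr_expR oppr_lt0 y0 => /(_ isT).
by rewrite lnV ?posrE ?expR_gt0// expRK opprK expR0.
Qed.

Lemma ln_prod_box_le (s : nat) (d : nat) y : (1 <= s)%N -> 0 < y -> (0 < d)%N ->
  (forall n : {ffun 'I_s -> nat}, (forall j : 'I_s, (n j < d)%N) ->
    index_cost m a b n * lam < 2 * y) ->
  s%:R * ln d%:R <= ln C + q * ln s%:R + p * ln (1 + y).
Proof.
move=> s1 y0 d0 dy; have := prod_box_le s1 y0 dy.
rewrite prodr_const card_ord => box.
have s0 : 0 < s%:R :> R by rewrite ltr0n.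
have y1 : 0 < 1 + y by lra.
have dR : 0 < d%:R :> R by rewrite ltr0n.
have : ln (d%:R ^+ s) <= ln (C * s%:R `^ q * (1 + y) `^ p).
  by rewrite ler_ln// posrE ?exprn_gt0 ?mulr_gt0 ?powR_gt0.
by rewrite lnXn// !lnM ?posrE ?mulr_gt0 ?powR_gt0// !ln_powR mulr_natl.
Qed.

(** At the fixed accuracy [y = 1], the cube of indices below [m 0] would give (m 0)^s <= C s^q 2^p
    for all s. Positivity of [b] matters for the cost 0: the power of 0 with exponent 0 is 1. *)
Lemma necessary_m0 : m 0 = 1%N.
Proof.
apply/eqP; rewrite eqn_leq m_gt0 andbT leqNgt; apply/negP => m2.
have m2' : 1 < (m 0)%:R :> R by rewrite ltr1n.
have [n0 Hn0] := log_lt_linear (ln C + p * ln (1 + 1)) (ln_gt0 m2') q_ge0.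
have /= := Hn0 n0.+1 isT (leqnSn _); apply/negP; rewrite -leNgt addrAC.
apply: ln_prod_box_le => // n nm; rewrite /index_cost big1 ?mul0r// => j _.
have := nm j; rewrite -[X in (_ < X)%N](partial_sum1 m) => /block_index_lt.
by rewrite ltnS leqn0 => /(_ m_gt0)/eqP ->; rewrite powR0 ?mulr0// gt_eqF// b_gt0.
Qed.

(** Here s is fixed and only the accuracy varies, so s^q is absorbed in the constant and the
    logarithms of both sides are affine in t = ln z; comparing slopes gives the claim. *)
Lemma necessary_b : (sum_inv b <= p%:E)%E.
Proof.
apply: sum_inv_le => // s; have [->|s1] := posnP s.
  by rewrite big_ord0 ltW.
pose A := \sum_(j < s) a j.+1.
have A0 : 0 <= A by apply: sumr_ge0 => j _; exact/ltW/a_gt0.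
have l0 := lam_gt0.
(* Chosen so that 1 + (A + 1) z lam <= G z for all z >= 1. *)
pose G := 1 + (A + 1) * lam.
have G1 : 1 <= G by rewrite /G lerDl mulr_ge0 ?ltW// ltr_wpDl.
have s0 : 0 < s%:R :> R by rewrite ltr0n.
apply: (@linear_le_affine _ _ _ (ln C + q * ln s%:R + p * ln G)) => t t0.
have z1 : 1 <= expR t by rewrite -expR0 ler_expR.
pose z := expR t; have z0 : 0 < z by exact: expR_gt0.
(* Block indices below [K j] are at most z^(1/b_j), which bounds the cost, while [K j] itself
   exceeds z^(1/b_j), which bounds the size of the box from below. *)
pose K (j : 'I_s) := (Num.truncn (z `^ (b j.+1)^-1)).+1.
have y0 : 0 < (A + 1) * z * lam by rewrite !mulr_gt0// ltr_wpDl.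
have box : \prod_j (partial_sum m (K j))%:R <=
    C * s%:R `^ q * (1 + (A + 1) * z * lam) `^ p.
  apply: prod_box_le => // n nK.
  apply: (@le_lt_trans _ _ (A * z * lam)).
    rewrite ler_wpM2r ?(ltW l0)// /index_cost /A mulr_suml ler_sum// => j _.
    rewrite ler_wpM2l ?(ltW (a_gt0 _))//.
    have := block_index_lt m_gt0 (nK j); rewrite ltnS => nj.
    have bj := b_gt0 (ltn0Sn j); have bj0 : b j.+1 != 0 by rewrite gt_eqF.
    have zE : z = z `^ (b j.+1)^-1 `^ b j.+1.
      by rewrite -powRrM mulVf// powRr1// ltW.
    rewrite [leRHS]zE.
    apply: ge0_ler_powR; rewrite ?nnegrE ?powR_ge0 ?ler0n ?(ltW bj)//.
    apply: (@le_trans _ _ (Num.truncn (z `^ (b j.+1)^-1))%:R).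
      by rewrite ler_nat.
    by rewrite truncn_le powR_ge0.
  have : 0 <= A * z * lam by rewrite !mulr_ge0 ?(ltW z0) ?(ltW l0).
  have : 0 < z * lam by rewrite mulr_gt0.
  lra.
have z_le : z `^ (\sum_(j < s) (b j.+1)^-1) <= C * s%:R `^ q * (G * z) `^ p.
  apply: le_trans (le_trans _ box) _.
    have -> : z `^ (\sum_(j < s) (b j.+1)^-1) = \prod_(j < s) z `^ (b j.+1)^-1.
      by rewrite /powR gt_eqF// mulr_suml expR_sum.
    apply: ler_prod => j _; rewrite powR_ge0/=.
    apply: (@le_trans _ _ (K j)%:R); first exact/ltW/truncnS_gt.
    by rewrite ler_nat partial_sum_ge.
  rewrite ler_wpM2l ?mulr_ge0 ?powR_ge0 ?(ltW C_gt0)//.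
  apply: ge0_ler_powR; rewrite ?nnegrE ?(ltW p_gt0)//.
  - by rewrite addr_ge0 ?(ltW y0).
  - by rewrite mulr_ge0 ?ltW// (lt_le_trans ltr01).
  - by rewrite /G [leRHS]mulrDl mul1r lerD// mulrAC.
have G0 : 0 < G by exact: lt_le_trans ltr01 G1.
have : ln (z `^ (\sum_(j < s) (b j.+1)^-1)) <= ln (C * s%:R `^ q * (G * z) `^ p).
  by rewrite ler_ln// posrE ?mulr_gt0 ?powR_gt0 ?mulr_gt0.
rewrite !lnM ?posrE ?mulr_gt0 ?powR_gt0 ?mulr_gt0// !ln_powR lnM ?posrE//.
by rewrite expRK [in leLHS]mulrC mulrDr (mulrC p t); lra.
Qed.

(** The accuracy y = s a_s lam admits all choices of blocks 0 and 1, because [a] is nondecreasing.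
    If a_s < e^(delta s), then ln (1 + y) is at most delta s + ln s + ln G, and the complexity bound
    fails for large s as delta p < ln (1 + m_1). *)
Lemma ln_a_ge (delta : R) : delta * p < ln (1 + (m 1)%:R) ->
  exists N0, forall s, (N0 <= s)%N -> (delta%:E <= (ln (a s) / s%:R)%:E)%E.
Proof.
(* [G] is such that 1 + s a_s lam <= s a_s G, because s a_s >= a_1. *)
move=> dp; pose M1 := ln (1 + (m 1)%:R : R); pose G := 1 / a 1 + lam.
have l0 := lam_gt0; have a1 := a_gt0 (leqnn 1).
have G0 : 0 < G by rewrite /G addr_gt0// divr_gt0.
have A0 : 0 < M1 - delta * p by rewrite subr_gt0.
(* The factor s in y adds p ln s to the term q ln s of the bound. *)
have qp0 : 0 <= q + p by rewrite addr_ge0 ?(ltW p_gt0).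
have [n0 Hn0] := log_lt_linear (ln C + p * ln G) A0 qp0.
exists n0.+1 => s sn0; have s1 : (0 < s)%N by exact: leq_trans sn0.
have s0 : 0 < s%:R :> R by rewrite ltr0n.
have as0 := a_gt0 s1.
rewrite lee_fin ler_pdivlMr// leNgt; apply/negP => as_lt.
have y0 : 0 < s%:R * a s * lam by rewrite !mulr_gt0.
have d0 : (0 < m 0 + m 1)%N by rewrite addn_gt0 m_gt0.
have box : s%:R * ln (m 0 + m 1)%:R <=
    ln C + q * ln s%:R + p * ln (1 + s%:R * a s * lam).
  apply: ln_prod_box_le => // n nd.
  apply: (@le_lt_trans _ _ (s%:R * a s * lam)); last by rewrite ltr_pMl ?ltr1n.
  rewrite ler_wpM2r ?(ltW l0)// /index_cost.
  apply: (@le_trans _ _ (\sum_(j < s) a s)); last first.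
    by rewrite sumr_const card_ord mulr_natl.
  apply: ler_sum => j _; rewrite -[leRHS]mulr1 ler_pM ?powR_ge0 ?(ltW (a_gt0 _))//.
    by apply: a_le; rewrite ltn_ord.
  have : (block_index m (n j) < 2)%N.
    apply: block_index_lt => //; have := nd j.
    by rewrite partial_sumS partial_sum1.
  have bj := b_gt0 (ltn0Sn j).
  case: (block_index m (n j)) => [_|[_|//]]; last by rewrite powR1.
  by rewrite powR0 ?gt_eqF.
have M1le : M1 <= ln (m 0 + m 1)%:R.
  by rewrite ler_ln ?posrE ?ltr0n ?addn_gt0 ?m_gt0// ?ltr_wpDr// natrD lerD2r ler1n.
have yle : ln (1 + s%:R * a s * lam) <= ln s%:R + ln (a s) + ln G.
  have sa0 : 0 < s%:R * a s by rewrite mulr_gt0.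
  have y1 : 0 < 1 + s%:R * a s * lam by rewrite addr_gt0.
  rewrite -!lnM ?posrE// ler_ln ?posrE ?(mulr_gt0 sa0)//.
  rewrite /G mulrDr lerD2r mul1r ler_pdivlMr// mul1r.
  apply: (@le_trans _ _ (a s)); first by apply: a_le; rewrite s1.
  by rewrite ler_peMl ?(ltW as0)// ler1n.
have := Hn0 s s1 (ltnW sn0).
have : p * ln (1 + s%:R * a s * lam) <= p * (ln s%:R + (delta * s%:R) + ln G).
  by rewrite ler_wpM2l ?(ltW p_gt0)// (le_trans yle)// lerD2r lerD2l ltW.
have : s%:R * M1 <= s%:R * ln (m 0 + m 1)%:R by rewrite ler_wpM2l ?(ltW s0).
lra.
Qed.

Lemma alpha_star_ge (delta : R) : delta * p < ln (1 + (m 1)%:R) ->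
  (delta%:E <= alpha_star a)%E.
Proof. by move=> /ln_a_ge[n0 Hn0]; exact: limn_einf_ge Hn0. Qed.

Lemma ln_1m1_gt0 : 0 < ln (1 + (m 1)%:R) :> R.
Proof. by rewrite ln_gt0// ltrDl ltr0n. Qed.

Lemma necessary_alpha : (0 < alpha_star a)%E.
Proof.
have M0 := ln_1m1_gt0; pose delta : R := ln (1 + (m 1)%:R) / (2 * p).
have d0 : 0 < delta by rewrite divr_gt0// mulr_gt0.
apply: (@lt_le_trans _ _ delta%:E); first by rewrite lte_fin.
apply: alpha_star_ge; rewrite /delta invfM mulrA divfK ?gt_eqF//.
by rewrite ltr_pdivrMr// ltr_pMr// ltr1n.
Qed.

Lemma necessary_exponent : ((ln (1 + (m 1)%:R))%:E / alpha_star a <= p%:E)%E.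
Proof.
have M0 := ln_1m1_gt0.
have Malpha : ((ln (1 + (m 1)%:R) / p)%:E <= alpha_star a)%E.
  (* [alpha_star_ge] needs a strict inequality, so it is applied slightly below the critical
     value. *)
  apply/lee_subgt0Pr => eps eps0; rewrite -EFinB; apply: alpha_star_ge.
  by rewrite mulrBl divfK ?gt_eqF// ltrBlDr ltrDl mulr_gt0.
move: necessary_alpha Malpha; case: (alpha_star a) => [r| |]//.
- rewrite lte_fin lee_fin => r0; rewrite ler_pdivrMr// => Mr.
  by rewrite inver gt_eqF// -EFinM lee_fin ler_pdivrMr// mulrC.
- by move=> _ _; rewrite invey mule0 lee_fin (ltW p_gt0).
Qed.

End Necessary.

(** * Sufficiency of the conditions and upper bound for the exponent *)

Section Sufficient.
Hypothesis m_bounded : exists M : nat, forall i : nat, (m i <= M)%N.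
Hypothesis m0 : m 0 = 1%N.
Local Notation c := (1 + m_max R m).

Lemma m_le_max i : (1 <= i)%N -> (m i)%:R <= m_max R m.
Proof.
move=> i1; apply: ub_le_sup; last by exists i.
by have [M mM] := m_bounded; exists M%:R => _ [l _ <-]; rewrite ler_nat.
Qed.

Lemma m_max_ge1 : 1 <= m_max R m.
Proof. by apply: le_trans (m_le_max (leqnn 1)); rewrite ler1n. Qed.

(** The constant term is 1 because [m 0 = 1]; the later blocks are controlled by [m_max]. *)
Lemma partial_sum_le i : (partial_sum m i.+1)%:R <= 1 + m_max R m * i%:R :> R.
Proof.
elim: i => [|i IH]; first by rewrite partial_sum1 m0 mulr0 addr0.
by rewrite partial_sumS natrD mulrS mulrDr mulr1 addrCA addrC lerD// m_le_max.
Qed.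

(** The bound does not depend on s, which is what makes strong tractability possible. *)
Lemma prod_ifltn_le (x : R) (T s : nat) : 1 <= x ->
  \prod_(j < s) (if (j < T)%N then x else 1) <= x ^+ T.
Proof.
move=> x1; suff -> : \prod_(j < s) (if (j < T)%N then x else 1) = x ^+ minn s T.
  by rewrite ler_weXn2l// geq_minr.
elim: s => [|s IH]; first by rewrite big_ord0 min0n.
rewrite big_ord_recr/= IH; have [sT|Ts] := ltnP s T.
  by rewrite (minn_idPl sT) exprSr.
by rewrite (minn_idPr (leqW Ts)) mulr1.
Qed.

Section Bound.
Context (beta delta : R) (J : nat).
Hypothesis b_sum : forall s, \sum_(j < s) (b j.+1)^-1 <= beta.
Hypothesis delta_gt0 : 0 < delta.
Hypothesis a_growth : forall j, (J <= j)%N -> delta * j.+1%:R < ln (a j.+1).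

(** Chosen so that [X = G * (1 + y)] dominates 1, the cost threshold [x] and all quotients x / a_j;
    the last term serves x / a_1, the largest quotient. *)
Let G := 1 + 2 / lam + 2 / lam / a 1.

Let G_gt0 : 0 < G.
Proof.
have l0 := lam_gt0.
by rewrite /G !addr_gt0 ?divr_gt0 ?a_gt0.
Qed.

Section FixedAccuracy.
Context (y : R).
Hypothesis y_gt0 : 0 < y.

Let x := 2 * y / lam.
Let X := G * (1 + y).

Let x_gt0 : 0 < x.
Proof. by rewrite /x divr_gt0 ?mulr_gt0 ?lam_gt0. Qed.

Let X_ge1 : 1 <= X.
Proof.
have l0 := lam_gt0; have y0 := y_gt0; have a1 := a_gt0 (leqnn 1).
have h1 : 0 < 2 / lam by rewrite divr_gt0.
have h2 : 0 < 2 / lam / a 1 by rewrite divr_gt0.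
rewrite /X /G; nra.
Qed.

Let x_le : x <= X.
Proof.
have l0 := lam_gt0; have y0 := y_gt0; have a1 := a_gt0 (leqnn 1).
have h1 : 0 < 2 / lam by rewrite divr_gt0.
have h2 : 0 < 2 / lam / a 1 by rewrite divr_gt0.
have -> : x = 2 / lam * y by rewrite /x mulrAC.
rewrite /X /G; nra.
Qed.

Let xa_le j : (1 <= j)%N -> x / a j <= X.
Proof.
move=> j1; apply: (@le_trans _ _ (x / a 1)).
  by rewrite ler_pM2l ?x_gt0// lef_pV2 ?posrE ?a_gt0// a_le.
have l0 := lam_gt0; have y0 := y_gt0; have a1 := a_gt0 (leqnn 1).
have h1 : 0 < 2 / lam by rewrite divr_gt0.
have h2 : 0 < 2 / lam / a 1 by rewrite divr_gt0.
have -> : x / a 1 = 2 / lam / a 1 * y by rewrite /x (mulrAC 2) [LHS]mulrAC.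
rewrite /X /G; nra.
Qed.

(** The real block index at which coordinate j alone costs x. *)
Let t j := (x / a j) `^ (b j)^-1.

(** Bounds the coordinates with a_(j+1) <= x: for j >= J such a coordinate has delta (j + 1) < ln
    X. *)
Let truncT := (J + (Num.truncn (ln X / delta)).+1)%N.

(** The side ends with block floor(t), so the block of [n j] exceeds t and this coordinate alone
    costs at least x. *)
Lemma box_outside s (n : {ffun 'I_s -> nat}) (j : 'I_s) :
  (partial_sum m (Num.truncn (t j.+1)).+1 <= n j)%N ->
  2 * y <= index_cost m a b n * lam.
Proof.
move=> /(block_index_ge m_gt0) nj; have l0 := lam_gt0.
rewrite -ler_pdivrMr// -/x /index_cost (bigD1 j)//=.
have aj := a_gt0 (ltn0Sn j); have bj := b_gt0 (ltn0Sn j).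
have bj0 : b j.+1 != 0 by rewrite gt_eqF.
apply: (@le_trans _ _ (a j.+1 * (block_index m (n j))%:R `^ b j.+1)); last first.
  rewrite lerDl sumr_ge0// => i _.
  by rewrite mulr_ge0 ?powR_ge0 ?(ltW (a_gt0 _)).
rewrite -ler_pdivrMl// mulrC.
have xa0 : 0 <= x / a j.+1 by rewrite divr_ge0 ?ltW ?x_gt0.
have -> : x / a j.+1 = t j.+1 `^ b j.+1 by rewrite /t -powRrM mulVf// powRr1.
apply: ge0_ler_powR; rewrite ?nnegrE ?powR_ge0 ?ler0n ?(ltW bj)//.
by apply: (le_trans (ltW (truncnS_gt _))); rewrite ler_nat.
Qed.

(** If a_(j+1) > x, then t < 1 and the side is [m 0 = 1]. Otherwise j < truncT, and t >= 1 absorbs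
    the constant: 1 + m_max t <= c t <= c X^(1/b_(j+1)). *)
Lemma box_side_le j : (partial_sum m (Num.truncn (t j.+1)).+1)%:R <=
  X `^ (b j.+1)^-1 * (if (j < truncT)%N then c else 1).
Proof.
have aj := a_gt0 (ltn0Sn j); have bj := b_gt0 (ltn0Sn j).
have mM := m_max_ge1.
have X1 : 1 <= X `^ (b j.+1)^-1.
  by rewrite -(powRr0 X) ler_powR ?X_ge1// invr_ge0 ltW.
have xa0 : 0 < x / a j.+1 by rewrite divr_gt0 ?x_gt0.
have p1 : 1 `^ (b j.+1)^-1 = 1 :> R by rewrite powR1.
have [ax|xa] := leP (a j.+1) x; last first.
  have -> : Num.truncn (t j.+1) = 0%N.
    apply/truncn0Pn; rewrite -ltNge -[ltRHS]p1.
    rewrite /t; apply: gt0_ltr_powR; rewrite ?invr_gt0// ?nnegrE ?(ltW xa0)//.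
    by rewrite ltr_pdivrMr// mul1r.
  rewrite partial_sum1 m0; case: ifP => _; last by rewrite mulr1.
  by rewrite -[leLHS]mulr1 ler_pM// lerDl (le_trans ler01).
have t1 : 1 <= t j.+1.
  rewrite -[leLHS]p1; apply: ge0_ler_powR.
  - by rewrite invr_ge0 ltW.
  - by rewrite nnegrE.
  - by rewrite nnegrE ltW.
  - by rewrite ler_pdivlMr// mul1r.
have tX : t j.+1 <= X `^ (b j.+1)^-1.
  apply: ge0_ler_powR; rewrite ?nnegrE ?invr_ge0 ?(ltW bj) ?(ltW xa0) ?xa_le//.
  exact: le_trans ler01 X_ge1.
have -> : (j < truncT)%N.
  rewrite ltnNge; apply/negP => Tj.
  have := a_growth (leq_trans (leq_addr _ _) Tj); apply/negP; rewrite -leNgt.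
  apply: (@le_trans _ _ (ln X)).
    rewrite ler_ln ?posrE// ?(le_trans ax x_le)//.
    exact: lt_le_trans ltr01 X_ge1.
  rewrite mulrC -ler_pdivrMr//.
  apply: (le_trans (ltW (truncnS_gt _))); rewrite ler_nat.
  by rewrite (leq_trans _ (leqnSn _))// (leq_trans _ Tj)// leq_addl.
apply: (le_trans (partial_sum_le _)).
apply: (@le_trans _ _ (t j.+1 * c)); last by rewrite ler_wpM2r// addr_ge0// (le_trans ler01).
rewrite mulrDr mulr1 lerD// mulrC ler_wpM2r ?(le_trans ler01)//.
by rewrite truncn_le powR_ge0.
Qed.

(** The powers of X multiply to at most X^beta. The factors c give at most c^(J+1) c^(ln X / delta),
    and c^(ln X / delta) = X^(ln c / delta), so the count is polynomial in 1 + y. *)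
Lemma box_prod_le s :
  \prod_(j < s) (partial_sum m (Num.truncn (t j.+1)).+1)%:R <=
  c ^+ J.+1 * G `^ (beta + ln c / delta) * (1 + y) `^ (beta + ln c / delta).
Proof.
have mM := m_max_ge1; have c1 : 1 <= c by rewrite lerDl (le_trans ler01).
have c0 : 0 < c by exact: lt_le_trans ltr01 c1.
have X0 : 0 < X by exact: lt_le_trans ltr01 X_ge1.
apply: (@le_trans _ _ (\prod_(j < s)
    (X `^ (b j.+1)^-1 * (if (j < truncT)%N then c else 1)))).
  by apply: ler_prod => j _; rewrite ler0n box_side_le.
rewrite big_split/= -mulrA -powRM ?(ltW G_gt0) ?addr_ge0 ?(ltW y_gt0)//.
have X_ne0 : X != 0 by rewrite gt_eqF.
rewrite -/X powRD ?X_ne0 ?implybT// mulrCA.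
apply: ler_pM.
- by apply: prodr_ge0 => j _; rewrite powR_ge0.
- by apply: prodr_ge0 => j _; case: ifP => _ //; exact: ltW.
- apply: (@le_trans _ _ (X `^ (\sum_(j < s) (b j.+1)^-1))).
    by rewrite /powR gt_eqF// mulr_suml expR_sum.
  by rewrite ler_powR.
apply: (le_trans (prod_ifltn_le _ _ c1)).
rewrite /truncT addnS -addSn exprD ler_wpM2l ?exprn_ge0 ?(ltW c0)//.
rewrite -powR_mulrn ?(ltW c0)//.
have -> : X `^ (ln c / delta) = c `^ (ln X / delta).
  by rewrite /powR !gt_eqF// mulrAC (mulrC (ln c)) mulrAC.
by rewrite ler_powR// truncn_le divr_ge0 ?ln_ge0 ?X_ge1 ?ltW.
Qed.

End FixedAccuracy.

Lemma ec_bound_sufficient :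
  exists2 C, 0 < C & ec_bound N C (beta + ln c / delta) 0.
Proof.
have mM := m_max_ge1; have c0 : 0 < c by rewrite ltr_wpDr// (le_trans ler01).
exists (c ^+ J.+1 * G `^ (beta + ln c / delta)).
  by rewrite mulr_gt0 ?exprn_gt0 ?powR_gt0 ?G_gt0.
move=> s eps s1 /andP[eps0 eps1]; pose y := - ln eps.
have y0 : 0 < y by rewrite oppr_gt0 ln_lt0// eps0.
rewrite powRr0 mulr1 lnV ?posrE// -/y.
have -> : eps = expR (- y) by rewrite opprK lnK.
pose d (j : 'I_s) :=
  partial_sum m (Num.truncn ((2 * y / lam / a j.+1) `^ (b j.+1)^-1)).+1.
apply: (@le_trans _ _ (\prod_j (d j)%:R)%:E); last first.
  by rewrite lee_fin box_prod_le.
apply: information_complexity_box_le => // n j; exact: box_outside.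
Qed.

End Bound.

(** The choice delta = ln c / (p - B) turns the exponent B + ln c / delta into p, and the strict
    hypothesis makes delta < alpha*, so that a_j > e^(delta j) eventually. *)
Lemma EC_SPT_with_sufficient (p : R) :
  (0 < alpha_star a)%E ->
  (sum_inv b + (ln c)%:E / alpha_star a < p%:E)%E -> 0 < p /\ EC_SPT_with N p.
Proof.
move=> alpha0.
have M0 : 0 < ln c by rewrite ln_gt0// ltrDl (lt_le_trans ltr01 m_max_ge1).
(* [v] treats finite and infinite alpha* alike; it is 0 in the infinite case. *)
have [v [-> v0 vw]] : exists v, [/\ ((ln c)%:E / alpha_star a = v%:E)%E, 0 <= v &
    forall w, v < w -> ((ln c / w)%:E < alpha_star a)%E].
  move: alpha0; case: (alpha_star a) => [r| |]// => [r0|_].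
    rewrite lte_fin in r0; exists (ln c / r); split.
    - by rewrite inver gt_eqF.
    - by rewrite divr_ge0 ?ltW.
    - move=> w rw; rewrite lte_fin ltr_pdivrMr.
        by rewrite mulrC -ltr_pdivrMr.
      by apply: le_lt_trans rw; rewrite divr_ge0 ?ltW.
  by exists 0; split => // [|w _]; rewrite ?invey ?mule0 ?ltry.
have B0 n : ((\sum_(j < n) (b j.+1)^-1)%:E <= sum_inv b)%E by exact: sum_inv_ge.
have := B0 0%N; rewrite big_ord0.
case: (sum_inv b) B0 => [B| |]//= b_sum; rewrite ?lte_fin ?lee_fin => B0 Bvp.
have w0 : v < p - B by rewrite ltrBrDl.
have pB0 : 0 < p - B by exact: le_lt_trans w0.
split; first by rewrite -(subrK B p) ltr_wpDr.
have delta0 : 0 < ln c / (p - B) by rewrite divr_gt0.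
have [J HJ] := limn_einf_gt (vw _ w0).
have a_growth j : (J <= j)%N -> ln c / (p - B) * j.+1%:R < ln (a j.+1).
  by move=> Jj; have := HJ j.+1 (leqW Jj); rewrite lte_fin ltr_pdivlMr.
have [C C0 bC] := ec_bound_sufficient (fun n => b_sum n) delta0 a_growth.
exists C => //; move: bC; congr (ec_bound _ _ _ _).
by rewrite invf_div mulrC divfK ?gt_eqF// addrC subrK.
Qed.

End Sufficient.
End Tractability.

(* In the extended reals, x / +oo = 0. *)
Theorem theorem9 (R : realType) (k : scalar_kind) (H : hilbertSpace R k)
    (e : nat -> H) (Hs : forall s : nat, hilbert_tensor_power H s)
    (omega : R) (m : nat -> nat) (a b : nat -> R)
    (e_basis : orthonormal_basis e)
    (omega01 : 0 < omega < 1)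
    (m_gt0 : forall i : nat, (0 < m i)%N)
    (m_bounded : exists M : nat, forall i : nat, (m i <= M)%N)
    (a_gt0 : forall j : nat, (1 <= j)%N -> 0 < a j)
    (a_ndecr : forall j : nat, (1 <= j)%N -> a j <= a j.+1)
    (b_gt0 : forall j : nat, (1 <= j)%N -> 0 < b j)
    (b_inf : 0 < inf [set b j | j in [set j : nat | (1 <= j)%N]]) :
  let N := fun (s : nat) (eps : R) =>
    information_complexity e omega m a b (Hs s) eps in
  let B := sum_inv b in
  let alpha := alpha_star a in
  let conditions := [/\ m 0%N = 1%N, (B < +oo)%E & (0 < alpha)%E] in
  let pstar := EC_SPT_exponent N in
  [/\ EC_PT N <-> EC_SPT N,
      EC_SPT N <-> conditions &
      conditions ->
        [/\ (Order.max B ((ln (1 + (m 1%N)%:R))%:E / alpha) <= pstar)%E,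
            (pstar <= B + (ln (1 + m_max R m))%:E / alpha)%E &
            alpha = +oo%E -> pstar = B]].
Proof.
move=> N B alpha conditions pstar.
(* Used twice: for arbitrary q to derive the conditions, and for q = 0 to bound the exponent from
   below. *)
have necessary C p q : 0 < C -> 0 < p -> 0 <= q -> ec_bound N C p q ->
    [/\ conditions, (B <= p%:E)%E & ((ln (1 + (m 1)%:R))%:E / alpha <= p%:E)%E].
  move=> C0 p0 q0 NC.
  have Bp := necessary_b e_basis omega01 m_gt0 a_gt0 b_gt0 C0 p0 NC.
  split => //.
    split.
    - exact: (necessary_m0 e_basis omega01 m_gt0 b_gt0 C0 q0 NC).
    - exact: le_lt_trans Bp (ltry _).
    - exact: (necessary_alpha e_basis omega01 m_gt0 a_gt0 a_ndecr b_gt0 C0 p0 q0 NC).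
  exact: (necessary_exponent e_basis omega01 m_gt0 a_gt0 a_ndecr b_gt0 C0 p0 q0 NC).
have sufficient p : conditions -> (B + (ln (1 + m_max R m))%:E / alpha < p%:E)%E ->
    0 < p /\ EC_SPT_with N p.
  case=> m01 _ alpha0.
  exact: (EC_SPT_with_sufficient Hs e_basis omega01 m_gt0 a_gt0 a_ndecr b_gt0
    m_bounded m01 alpha0).
(* Finiteness provides real exponents strictly above the bound, to which [sufficient] applies. *)
have bound_fin : conditions -> exists x : R,
    (B + (ln (1 + m_max R m))%:E / alpha = x%:E)%E.
  case=> _ Bfin alpha0; have B0 : (0 <= B)%E.
    by have := sum_inv_ge 0 b_gt0; rewrite big_ord0.
  move: B0 Bfin alpha0; rewrite /B /alpha.
  case: (sum_inv b) => [r| |]// _ _; case: (alpha_star a) => [t| |]//.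
    rewrite lte_fin => t0; rewrite inver gt_eqF//.
    by exists (r + ln (1 + m_max R m) / t).
  by move=> _; exists r; rewrite invey mule0 adde0.
have sufficient_SPT : conditions -> EC_SPT N.
  move=> conds; have [x xE] := bound_fin conds.
  have [|p0 SPTp] := sufficient (x + 1) conds; first by rewrite xE lte_fin ltrDl.
  by exists (x + 1).
have PT_of_SPT : EC_SPT N -> EC_PT N.
  by move=> [p p0 [C C0 NC]]; exists C, p, 0.
have necessary_PT : EC_PT N -> conditions.
  by move=> [C [p [q [C0 p0 q0 /necessary[]]]]].
have lower : (Order.max B ((ln (1 + (m 1)%:R))%:E / alpha) <= pstar)%E.
  apply: le_ereal_inf_tmp => _ [p [p0 [C C0 NC]] <-].
  by have [_ Bp Mp] := necessary C p 0 C0 p0 (lexx 0) NC; rewrite ge_max Bp.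
have upper : conditions -> (pstar <= B + (ln (1 + m_max R m))%:E / alpha)%E.
  move=> conds; have [x xE] := bound_fin conds.
  (* Every [x + eps] is an admissible exponent, so the infimum is at most x whether or not x is
     admissible. *)
  rewrite xE; apply/lee_addgt0Pr => eps eps0; apply: ereal_inf_lbound.
  by exists (x + eps) => //; apply: sufficient => //; rewrite xE lte_fin ltrDl.
split.
- by split => [/necessary_PT/sufficient_SPT|/PT_of_SPT].
- by split => [/PT_of_SPT/necessary_PT|/sufficient_SPT].
- move=> conds; split=> [||alphay]; [exact: lower|exact: upper|].
  apply/eqP; rewrite eq_le; apply/andP; split.
    by have := upper conds; rewrite alphay invey mule0 adde0.
  by apply: le_trans lower; rewrite le_max lexx.
Qed.
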